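(* Consider the $\mathcal A_6$-seed with variables $a_1,\dots,a_6,b_1,\dots,b_6,c_1,c_2,c_3$, its Casimir functions $K_1,K_2,K_3$, the matrix $\Psi=(\psi_{ik})$, the minors $\psi_{44}$, $\det\Psi_{[3,5]}^{[3,5]}$, $\det\Psi_{[2,6]}^{[2,6]}$, the Cases 1, 2, 3, and the two explicit mutation sequences, all described in the context. Then: (1) The first mutation sequence permutes (interchanges) the Casimir functions $K_2$ and $K_3$ of Case 2 and Case 3, leaving the Casimir function $K_1$ of Case 1 unchanged. It also permutes the expressions for the minors $\det\Psi_{[3,5]}^{[3,5]}$ and $\det\Psi_{[2,6]}^{[2,6]}$ giving the second conditions of Cases 2 and 3. Therefore the first mutation sequence permutes Case 2 and Case 3, leaving Case 1 unchanged. (2) The second mutation sequence cyclically permutes Case 1, Case 2 and Case 3.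
   Context: **Quiver and mutations.** The $\mathcal A_6$-quiver has vertices $a_i,b_i$ ($i\in\mathbb Z/6$) and $c_1,c_2,c_3$, and arrows $a_i\to a_{i+1}$, $b_i\to b_{i+1}$, $a_{i+1}\to b_i$, $b_i\to a_i$ for all $i$ modulo $6$, together with $b_6\to c_1\to b_5$, $b_3\to c_1\to b_2$, $b_4\to c_2\to b_3$, $b_1\to c_2\to b_6$, $b_2\to c_3\to b_1$, $b_5\to c_3\to b_4$, and $c_1\to c_2\to c_3\to c_1$. Write $B_{ij}$ for the number of arrows from $i$ to $j$ minus the number from $j$ to $i$. The Poisson bracket of a seed is $\{x_i,x_j\}=B_{ij}x_ix_j$; a Casimir function is one that Poisson commutes with all functions. Mutation at vertex $k$: the quiver changes by (i) adding an arrow $i\to j$ for each path $i\to k\to j$, (ii) reversing all arrows at $k$, (iii) cancelling oriented 2-cycles; the variables change by $x_k'=x_k^{-1}$ and $x_i'=x_i\bigl(1+x_k^{-\operatorname{sgn}(B_{ik})}\bigr)^{-B_{ik}}$ for $i\ne k$. **Casimir functions.** $K_1=c_1c_2c_3$, $K_2=b_1\cdots b_6\,c_1c_2c_3$, $K_3=a_1\cdots a_6\,b_1\cdots b_6\,c_1c_2c_3$. **The matrix $\Psi$.** Put $T_1=a_5$, $T_2=b_4b_5$, $T_3=c_1c_2c_3$, $T_4=b_1b_2b_3b_6$, $T_5=a_1a_2a_3a_4a_6$, and let $u_1=()$, $u_2=(b_5)$, $u_3=(c_1,c_3)$, $u_4=(b_3,b_2,b_1)$, $u_5=(a_4,a_3,a_2,a_1)$.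 For $1\le i,k\le 6$ let $p_{ik}=0$ if $i+k<7$, and if $i+k\ge7$ let $$p_{ik}=\prod_{\ell=1}^{6-k}T_\ell\cdot\sum\ \prod_{\ell=7-k}^{i-1}\bigl(\text{product of the first } s_\ell-1 \text{ entries of } u_\ell\bigr),$$ the sum being over all weakly decreasing sequences $s_{7-k}\ge s_{8-k}\ge\dots\ge s_{i-1}$ of integers with $1\le s_\ell\le\ell$ (empty products are $1$; for $i=7-k$ the sum is $1$). Set $\psi_{ik}=(-1)^kp_{ik}+(-1)^ip_{ki}$. Then $\Psi$ is symmetric, $\psi_{ik}=0$ for $i+k<7$, and up to a nonzero scalar and congruence by an invertible diagonal matrix (which change minors only by nonzero factors) it is the matrix $\mathcal M_3S+S^T\mathcal M_3^T$ built from the upper-triangular transport matrix $\mathcal M_3$ in Fock–Goncharov parameters and the antidiagonal matrix $S$ with entries $1,-1,1,-1,1,-1$ from the top row down; it has the same rank as $A+A^T$, where $A$ is the unipotent upper-triangular $6\times6$ matrix parametrized by the seed. $\Psi_{[p,q]}^{[p,q]}$ denotes the submatrix with rows and columns $p,\dots,q$. **The Cases.** The condition $\operatorname{rank}(A+A^T)\le4$ splits into three cases. Case 1: $\psi_{34}=\psi_{43}=0$ (equivalently $K_1=1$) and $\psi_{44}=0$. Case 2: $\psi_{25}=\psi_{52}=0$ (equivalently $K_2=1$) and $\det\Psi_{[3,5]}^{[3,5]}=0$. Case 3: $\psi_{16}=\psi_{61}=0$ (equivalently $K_3=1$) and $\det\Psi_{[2,6]}^{[2,6]}=0$. **The mutation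 sequences.** Let $P$ be the following sequence of mutations, applied from left to right: at $b_6,b_2,b_4$; at $c_1,c_2,c_3$; at $c_1,a_1,a_2$; at $c_2,a_5,a_6$; at $c_3,a_3,a_4$; at $b_1$; at $b_6,b_2$. Let $P^{-1}$ be the same mutations in reverse order. Relabeling $x\leftrightarrow y$ means exchanging the names of these two vertices (together with their variables). First sequence: $P$; mutations at $b_1$ and $b_4$; relabeling $b_1\leftrightarrow b_4$; $P^{-1}$. Second sequence: $P$; mutations at $b_1$ and $b_4$; again mutations at $b_1$ and $b_4$; mutations at $b_3$ and $b_5$; relabelings $b_1\leftrightarrow b_4$ and $b_3\leftrightarrow b_5$; mutations at $b_1$ and $b_4$; $P^{-1}$. Both sequences return the $\mathcal A_6$-quiver to itself. A sequence induces a permutation $\tau$ of the Casimir functions if each $K_j$, rewritten in the variables of the resulting seed, is the monomial defining $K_{\tau(j)}$ in those variables; it permutes the Cases by $\tau$ if the conditions defining Case $j$, rewritten in the variables of the resulting seed, become the conditions defining Case $\tau(j)$ (the minors being considered as expressions giving these conditions). *)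

(* Defs.v *)
From HB Require Import structures.
From mathcomp Require Import all_boot all_order all_algebra all_fingroup.
From mathcomp Require Import mpoly.

Set Implicit Arguments.
Unset Strict Implicit.
Unset Printing Implicit Defensive.

Import GRing.Theory.
Local Open Scope ring_scope.

(* Indices are residues, so the usual 1-based names can be written verbatim:
   [a 6], [b 6] and [c 3] denote [a 0], [b 0] and [c 0]. *)
Definition vertex : finType := ('Z_6 + 'Z_6 + 'Z_3)%type.
Definition a (i : 'Z_6) : vertex := inl (inl i).
Definition b (i : 'Z_6) : vertex := inl (inr i).
Definition c (i : 'Z_3) : vertex := inr i.

(* [Q i j] is the number of arrows from i to j. *)
Definition quiver := vertex -> vertex -> nat.

Definition residues : seq 'Z_6 := [:: 1; 2; 3; 4; 5; 6].

Definition A6_arrows : seq (vertex * vertex) :=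
  [seq (a i, a (i + 1)) | i <- residues] ++
  [seq (b i, b (i + 1)) | i <- residues] ++
  [seq (a (i + 1), b i) | i <- residues] ++
  [seq (b i, a i) | i <- residues] ++
  [:: (b 6, c 1); (c 1, b 5); (b 3, c 1); (c 1, b 2);
      (b 4, c 2); (c 2, b 3); (b 1, c 2); (c 2, b 6);
      (b 2, c 3); (c 3, b 1); (b 5, c 3); (c 3, b 4);
      (c 1, c 2); (c 2, c 3); (c 3, c 1)].

Definition A6_quiver : quiver := fun i j => count_mem (i, j) A6_arrows.

Definition exchange (Q : quiver) (i j : vertex) : int := (Q i j)%:Z - (Q j i)%:Z.

Definition add_paths (k : vertex) (Q : quiver) : quiver :=
  fun i j => (Q i j + Q i k * Q k j)%N.
Definition reverse_at (k : vertex) (Q : quiver) : quiver :=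
  fun i j => if (i == k) || (j == k) then Q j i else Q i j.
Definition cancel_2cycles (Q : quiver) : quiver :=
  fun i j => (Q i j - Q j i)%N.
Definition mutate_quiver (k : vertex) (Q : quiver) : quiver :=
  cancel_2cycles (reverse_at k (add_paths k Q)).

Record seed (F : fieldType) := Seed { quiv : quiver; var : vertex -> F }.

Definition mutate (F : fieldType) (k : vertex) (s : seed F) : seed F :=
  let B := exchange (quiv s) in
  let x := var s in
  Seed (mutate_quiver k (quiv s))
    (fun i => if i == k then (x k)^-1
              else x i * (1 + x k ^ (- Num.sg (B i k))) ^ (- B i k)).

Definition relabel (F : fieldType) (u v : vertex) (s : seed F) : seed F :=
  Seed (fun i j => quiv s (tperm u v i) (tperm u v j))
       (fun i => var s (tperm u v i)).

Inductive move := Mut of vertex | Relabel of vertex & vertex.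

Definition apply_move (F : fieldType) (m : move) (s : seed F) : seed F :=
  match m with Mut k => mutate k s | Relabel u v => relabel u v s end.

Definition apply_moves (F : fieldType) (ms : seq move) (s : seed F) : seed F :=
  foldl (fun s m => apply_move m s) s ms.

(* For nonzero variables, the mutation at k is defined with nonzero values
   exactly when x_k <> -1 (unless k is an isolated vertex). *)
Fixpoint mutable_along (F : fieldType) (ms : seq move) (s : seed F) : bool :=
  if ms is m :: ms' then
    (if m is Mut k then 1 + var s k != 0 else true)
      && mutable_along ms' (apply_move m s)
  else true.

Definition A6_seed (F : fieldType) (x : vertex -> F) : seed F := Seed A6_quiver x.

Definition in_domain (F : fieldType) (ms : seq move) (x : vertex -> F) : Prop :=
  (forall v, x v != 0) /\ mutable_along ms (A6_seed x).

(* The variables of the resulting seed, as functions of the initial ones. *)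
Definition new_vars (F : fieldType) (ms : seq move) (x : vertex -> F)
  : vertex -> F := var (apply_moves ms (A6_seed x)).

Definition returns_quiver (F : fieldType) (ms : seq move) : Prop :=
  forall x : vertex -> F, quiv (apply_moves ms (A6_seed x)) =2 A6_quiver.

Definition muts (vs : seq vertex) : seq move := [seq Mut v | v <- vs].

Definition P_vertices : seq vertex :=
  [:: b 6; b 2; b 4;  c 1; c 2; c 3;  c 1; a 1; a 2;  c 2; a 5; a 6;
      c 3; a 3; a 4;  b 1;  b 6; b 2].

Definition first_sequence : seq move :=
  muts P_vertices ++ muts [:: b 1; b 4] ++ [:: Relabel (b 1) (b 4)] ++
  muts (rev P_vertices).

Definition second_sequence : seq move :=
  muts P_vertices ++
  muts [:: b 1; b 4] ++ muts [:: b 1; b 4] ++ muts [:: b 3; b 5] ++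
  [:: Relabel (b 1) (b 4); Relabel (b 3) (b 5)] ++ muts [:: b 1; b 4] ++
  muts (rev P_vertices).

Definition mon (F : fieldType) (x : vertex -> F) (vs : seq vertex) : F :=
  \prod_(v <- vs) x v.

(* Casimir functions and Cases are indexed by 'Z_3, with index 3 = 0. *)
Definition casimir (F : fieldType) (j : 'Z_3) (x : vertex -> F) : F :=
  match val j with
  | 1%N => \prod_i x (c i)
  | 2%N => (\prod_i x (b i)) * \prod_i x (c i)
  | _ => (\prod_i x (a i)) * (\prod_i x (b i)) * \prod_i x (c i)
  end.

Definition T (l : nat) : seq vertex :=
  match l with
  | 1%N => [:: a 5]
  | 2%N => [:: b 4; b 5]
  | 3%N => [:: c 1; c 2; c 3]
  | 4%N => [:: b 1; b 2; b 3; b 6]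
  | 5%N => [:: a 1; a 2; a 3; a 4; a 6]
  | _ => [::]
  end.

Definition u (l : nat) : seq vertex :=
  match l with
  | 2%N => [:: b 5]
  | 3%N => [:: c 1; c 3]
  | 4%N => [:: b 3; b 2; b 1]
  | 5%N => [:: a 4; a 3; a 2; a 1]
  | _ => [::]
  end.

(* All sequences (s_l), l running through ls, with 1 <= s_l <= l. *)
Fixpoint boxed (ls : seq nat) : seq (seq nat) :=
  if ls is l :: ls' then [seq s :: t | s <- iota 1 l, t <- boxed ls']
  else [:: [::]].

(* The list [ls] is 7-k, ..., i-1. *)
Definition p (F : fieldType) (x : vertex -> F) (i k : nat) : F :=
  if (i + k < 7)%N then 0 else
  let ls := iota (7 - k) (i + k - 7) in
  (\prod_(1 <= l < 7 - k) mon x (T l)) *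
  \sum_(s <- boxed ls | sorted geq s)
    \prod_(ls_s <- zip ls s) mon x (take ls_s.2.-1 (u ls_s.1)).

Definition psi (F : fieldType) (x : vertex -> F) (i k : nat) : F :=
  (-1) ^+ k * p x i k + (-1) ^+ i * p x k i.

(* Rows and columns of Psi numbered lo, ..., hi (counting from 1). *)
Definition Psi_block (F : fieldType) (x : vertex -> F) (lo hi : nat)
  : 'M[F]_(hi.+1 - lo) := \matrix_(i, k) psi x (lo + i) (lo + k).

Definition first_condition (F : fieldType) (j : 'Z_3) (x : vertex -> F) : Prop :=
  match val j with
  | 1%N => psi x 3 4 = 0 /\ psi x 4 3 = 0
  | 2%N => psi x 2 5 = 0 /\ psi x 5 2 = 0
  | _ => psi x 1 6 = 0 /\ psi x 6 1 = 0
  end.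

Definition case_minor (F : fieldType) (j : 'Z_3) (x : vertex -> F) : F :=
  match val j with
  | 1%N => psi x 4 4
  | 2%N => \det (Psi_block x 3 5)
  | _ => \det (Psi_block x 2 6)
  end.

Definition Case (F : fieldType) (j : 'Z_3) (x : vertex -> F) : Prop :=
  first_condition j x /\ case_minor j x = 0.

Definition permutes_casimirs (F : fieldType) (ms : seq move) (tau : {perm 'Z_3})
  : Prop :=
  forall (j : 'Z_3) (x : vertex -> F), in_domain ms x ->
    casimir j x = casimir (tau j) (new_vars ms x).

Definition permutes_cases (F : fieldType) (ms : seq move) (tau : {perm 'Z_3})
  : Prop :=
  forall (j : 'Z_3) (x : vertex -> F), in_domain ms x ->
    (first_condition j x <-> first_condition (tau j) (new_vars ms x)) /\
    (Case j x <-> Case (tau j) (new_vars ms x)).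

Definition eval_at (F : fieldType) (x : vertex -> F) (q : {mpoly F[#|vertex|]})
  : F := q.@[fun i => x (enum_val i)].

(* The minors only matter as second conditions: the minor of Case j, rewritten
   in the new variables, is the minor of Case j' up to a rational factor N / D
   that has no zeros or poles where the first condition of Case j holds. *)
Definition minor_becomes (F : fieldType) (ms : seq move) (j j' : 'Z_3) : Prop :=
  exists N D : {mpoly F[#|vertex|]},
    forall x : vertex -> F, in_domain ms x -> first_condition j x ->
    [/\ eval_at x N != 0, eval_at x D != 0 &
        case_minor j x =
          eval_at x N / eval_at x D * case_minor j' (new_vars ms x)].

(* Main.v *)
Require Import Defs.
From mathcomp Require Import all_boot all_order all_algebra all_fingroup.
From mathcomp Require Import mpoly cyclic ring.

Set Implicit Arguments.
Unset Strict Implicit.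
Unset Printing Implicit Defensive.

Import Order.TTheory GRing.Theory Num.Theory.
Local Open Scope ring_scope.

(** Written in the variables of the final seed, the data of Case [tau j] are a
    monomial K (the Casimir function) and a polynomial (the minor).  Under one
    mutation at k, a Laurent monomial of the new seed becomes a Laurent monomial
    of the old one times a power of 1 + x_k ([mval_mutate]).  Hence a Laurent
    polynomial f of the new seed becomes (1 + x_k)^e f', with f' a Laurent
    polynomial of the old seed, and the factor has neither zero nor pole where
    the mutation is defined ([lval_mutate]).  The exponent of 1 + x_k vanishes
    for a Casimir monomial, which therefore stays a monomial and keeps its value.
    On the hypersurface K = 1 the exponent vectors of f only matter modulo the
    exponent vector of K; with this reduction, the powers of 1 + x_k that divide
    f' can be split off at every step, and f' stays small enough (a few
    thousand terms) to be computed.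

    Carrying the minor of Case [tau j] back through the whole sequence in this
    way ends, up to sign and a monomial, with the minor of Case j.  That is a
    finite computation with integer exponents and coefficients, the boolean
    [certificate_holds]; [transports_transported] gives it its meaning over an
    arbitrary field: the two minors differ by a quotient of polynomials without
    zeros on the domain of the sequence.  Both sequences have the form P, a
    short middle part, P^-1, so the three minors are carried through P^-1 and
    compared through P only once; in the seed reached by P, the middle parts
    permute the three resulting Laurent polynomials up to such factors, as (2 3)
    for the first sequence and as 1 -> 3 -> 2 -> 1 for the second.

    The remaining conditions come from [first_conditionE]: the two entries of
    Psi in the first condition of Case j are, up to sign, a monomial times
    1 - K_j. *)

(** * Numbering the vertices *)

Definition vertices : seq vertex :=
  [:: a 0; a 1; a 2; a 3; a 4; a 5; b 0; b 1; b 2; b 3; b 4; b 5;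
      c 0; c 1; c 2].

(** Since a 6 = a 0, the last vertex of each cycle comes first. *)
Definition rank (v : vertex) : nat :=
  match v with inl (inl i) => i | inl (inr i) => 6 + i | inr i => 12 + i end.

Lemma nth_vertices v0 v : nth v0 vertices (rank v) = v.
Proof.
by case: v => [[[i lti]|[i lti]]|[i lti]];
  do 6?[case: i lti => [|i] lti //=; first by
    (congr (inl (inl _)) || congr (inl (inr _)) || congr (inr _));
    apply: val_inj].
Qed.

Lemma map_rank_vertices : map rank vertices = iota 0 15.
Proof. by []. Qed.

Arguments vertices : simpl never.

Lemma rank_inj : injective rank.
Proof.
by apply: (can_inj (g := nth (a 0) vertices)) => v; exact: nth_vertices.
Qed.

Lemma rank_lt v : (rank v < 15)%N.
Proof.
case: v => [[i|i]|i] /=; have := ltn_ord i; rewrite /Zp_trunc /= => lti.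
- exact: leq_trans lti _.
- by rewrite -ltn_subRL (leq_trans lti).
- by rewrite -ltn_subRL.
Qed.

Lemma mem_vertices v : v \in vertices.
Proof. by rewrite -(nth_vertices v v) mem_nth ?rank_lt. Qed.

Lemma big_vertices (R : Type) (idx : R) (op : Monoid.com_law idx)
    (G : nat -> R) :
  \big[op/idx]_v G (rank v) = \big[op/idx]_(0 <= i < 15) G i.
Proof.
rewrite /index_iota subn0 -map_rank_vertices big_map; apply: perm_big.
apply: uniq_perm; rewrite ?index_enum_uniq //.
by move=> v; rewrite mem_vertices mem_index_enum.
Qed.

(** * Monomials *)

(** Exponent vectors indexed by [rank]; absent entries are zero, so that lists of
    different lengths may be combined. *)
Definition mono := seq int.

Fixpoint madd (m n : mono) : mono :=
  match m, n with
  | [::], _ => n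
  | _, [::] => m
  | x :: m', y :: n' => x + y :: madd m' n'
  end.

Definition mscale (t : int) (m : mono) : mono := [seq t * e | e <- m].

Fixpoint dot (m n : mono) : int :=
  if m is x :: m' then
    if n is y :: n' then x * y + dot m' n' else 0
  else 0.

Lemma nth_madd m n i : (madd m n)`_i = m`_i + n`_i.
Proof.
by elim: m n i => [|x m IH] [|y n] [|i] //=; rewrite ?nth_nil ?add0r ?addr0.
Qed.

Lemma nth_mscale t m i : (mscale t m)`_i = t * m`_i.
Proof.
have [lti|gei] := ltnP i (size m); first exact: nth_map.
by rewrite !nth_default ?mulr0 ?size_map.
Qed.

Lemma dot_vertices (g : vertex -> int) m :
  dot [seq g v | v <- vertices] m = \sum_v g v * m`_(rank v).
Proof.
have dotE : forall s n, dot s n = \sum_(0 <= i < size s) s`_i * n`_i.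
  elim=> [|x s IH] [|y n] /=; rewrite ?big_nil //.
    by rewrite big1 // => i _; rewrite nth_nil mulr0.
  by rewrite big_nat_recl // IH.
rewrite dotE size_map -(big_vertices _ (fun i => _`_i * m`_i)).
apply: eq_bigr => v _; congr (_ * _).
by rewrite (nth_map (a 0)) ?nth_vertices // rank_lt.
Qed.

Section MonomialValues.

Variables (F : fieldType) (x : vertex -> F).

Definition mval (m : mono) : F := \prod_v x v ^ m`_(rank v).

Hypothesis x_neq0 : forall v, x v != 0.

Lemma mval_neq0 m : mval m != 0.
Proof. by apply/prodf_neq0 => v _; rewrite expfz_neq0. Qed.

Lemma mval_add m n : mval (madd m n) = mval m * mval n.
Proof.
by rewrite -big_split; apply: eq_bigr => v _; rewrite nth_madd expfzDr.
Qed.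

Lemma mval_scale t m : mval (mscale t m) = mval m ^ t.
Proof.
rewrite /mval.
rewrite (big_morph (fun y : F => y ^ t) (fun y z => expfzMl y z t) (exp1rz F t)).
by apply: eq_bigr => v _; rewrite nth_mscale mulrC exprz_exp.
Qed.

Lemma mval_set k m e :
  mval (set_nth 0 m (rank k) e) =
    mval (set_nth 0 m (rank k) 0) * x k ^ e.
Proof.
rewrite /mval (bigD1 k) // [in RHS](bigD1 k) //= !nth_set_nth /= !eqxx.
rewrite expr0z mul1r mulrC; congr (_ * _); apply: eq_bigr => v vk.
by rewrite !nth_set_nth /= (inj_eq rank_inj) (negPf vk).
Qed.

Lemma mval_clear k m :
  mval m = mval (set_nth 0 m (rank k) 0) * x k ^ m`_(rank k).
Proof.
rewrite -mval_set; apply: eq_bigr => v _; rewrite nth_set_nth /=.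
by case: eqP => // ->.
Qed.

End MonomialValues.

(** * Laurent polynomials *)

(** Sums of terms in no particular order, possibly with repeated exponents. *)
Definition laurent := seq (mono * int).

(** The pair (lo, [:: e0; e1; ...]) is the Laurent polynomial
    y^lo (e0 + e1 y + ...). *)
Definition univariate := (int * seq int)%type.

(** A Laurent polynomial seen as a polynomial in one distinguished variable x_k,
    with coefficients that are monomials in the others: in each slice, entry k of
    the exponent vector is ignored. *)
Definition sliced := seq (mono * univariate).

Section LaurentValues.

Variables (F : fieldType) (x : vertex -> F).

Definition lval (f : laurent) : F := \sum_(t <- f) t.2%:~R * mval x t.1.

Definition horner_seq (y : F) (cs : seq int) : F :=
  foldr (fun e r => e%:~R + y * r) 0 cs.
Definition uval (y : F) (q : univariate) : F := y ^ q.1 * horner_seq y q.2.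
Definition sval (k : vertex) (g : sliced) : F :=
  \sum_(t <- g) mval x (set_nth 0 t.1 (rank k) 0) * uval (x k) t.2.

End LaurentValues.

(** When kap has entry 1 or -1 at p, this is the normal form modulo the monomial
    of kap in which x_p does not occur. *)
Definition reduce (kap : mono) (p : nat) (f : laurent) : laurent :=
  [seq (let e := t.1`_p in
        if e == 0 then t
        else (madd t.1 (mscale (- (e * kap`_p)) kap), t.2)) | t <- f].

Lemma lval_reduce (F : fieldType) (x : vertex -> F) kap p f :
  (forall v, x v != 0) -> mval x kap = 1 ->
  lval x (reduce kap p f) = lval x f.
Proof.
move=> x_neq0 kap1; rewrite /lval big_map; apply: eq_bigr => t _.
rewrite /=; have [//|_] := eqVneq t.1`_p 0; rewrite mval_add // mval_scale //.
by rewrite kap1 exp1rz mulr1.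
Qed.

Definition compare_int (x y : int) : comparison :=
  match x, y with
  | Posz i, Posz j => Nat.compare i j
  | Posz _, Negz _ => Gt
  | Negz _, Posz _ => Lt
  | Negz i, Negz j => Nat.compare j i
  end.

Fixpoint mle (m n : mono) : bool :=
  match m, n with
  | x :: m', y :: n' =>
    match compare_int x y with Eq => mle m' n' | Lt => true | Gt => false end
  | _, _ => true
  end.

Definition uadd (q1 q2 : univariate) : univariate :=
  match q2.1 - q1.1 with
  | Posz n => (q1.1, madd q1.2 (ncons n 0 q2.2))
  | Negz n => (q2.1, madd (ncons n.+1 0 q1.2) q2.2)
  end.

Fixpoint merge_equal (g : sliced) : sliced :=
  if g is t :: g' then
    let r := merge_equal g' in
    if r is t' :: r' then
      if t.1 == t'.1 then (t.1, uadd t.2 t'.2) :: r' else t :: r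
    else [:: t]
  else [::].

(** Sorting makes the terms with the same cofactor of the power of x_k adjacent. *)
Definition slice (k : nat) (f : laurent) : sliced :=
  merge_equal (sort (fun t t' => mle t.1 t'.1)
    [seq (set_nth 0 t.1 k 0, (t.1`_k, [:: t.2])) | t <- f]).

Fixpoint flatten_slice (k : nat) (m : mono) (lo : int) (cs : seq int)
    (f : laurent) : laurent :=
  if cs is e :: cs' then
    let r := flatten_slice k m (lo + 1) cs' f in
    if e == 0 then r else (set_nth 0 m k lo, e) :: r
  else f.

Definition unslice (k : nat) (g : sliced) : laurent :=
  foldr (fun t f => flatten_slice k t.1 t.2.1 t.2.2 f) [::] g.

Section SliceValues.

Variables (F : fieldType) (x : vertex -> F).
Hypothesis x_neq0 : forall v, x v != 0.

Lemma horner_madd y cs ds :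
  horner_seq y (madd cs ds) = horner_seq y cs + horner_seq y ds :> F.
Proof.
elim: cs ds => [|e cs IH] [|d ds] /=; rewrite ?add0r ?addr0 //.
by rewrite IH intrD mulrDr addrACA.
Qed.

Lemma horner_ncons y n cs :
  horner_seq y (ncons n 0 cs) = y ^+ n * horner_seq y cs :> F.
Proof.
by elim: n => [|n IH]; rewrite ?mul1r //= IH add0r exprS mulrA.
Qed.

Lemma uval_uadd y q1 q2 : y != 0 ->
  uval y (uadd q1 q2) = uval y q1 + uval y q2 :> F.
Proof.
move=> y0; case: q1 q2 => [l1 cs1] [l2 cs2].
rewrite /uadd -[_.1 - _.1]/(l2 - l1); case E: (l2 - l1) => [n|n];
  rewrite /uval horner_madd horner_ncons mulrDr mulrA [fst _]/= [snd _]/=.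
  have -> : l2 = l1 + n by rewrite -E addrC subrK.
  by rewrite expfzDr.
have -> : l1 = l2 + n.+1.
  by rewrite -[n.+1%:Z]opprK -NegzE -E opprB addrC subrK.
by rewrite expfzDr.
Qed.

Lemma sval_merge_equal k g : sval x k (merge_equal g) = sval x k g.
Proof.
elim: g => //= t g IH; rewrite /sval [in RHS]big_cons -/(sval x k g) -IH.
case: (merge_equal g) => [|t' r]; first by rewrite big_cons.
case: eqP => [e|_]; rewrite /sval !big_cons //=.
by rewrite uval_uadd // mulrDr -e addrA.
Qed.

Lemma sval_slice k f : sval x k (slice (rank k) f) = lval x f.
Proof.
rewrite sval_merge_equal /sval (perm_big _ (permEl (perm_sort _ _))) /= big_map.
apply: eq_bigr => t _ /=; rewrite set_set_nth eqxx (mval_clear x k t.1).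
by rewrite /uval /= mulr0 addr0 mulrA mulrC.
Qed.

Lemma lval_unslice k g : lval x (unslice (rank k) g) = sval x k g.
Proof.
have flatE m lo cs f :
    lval x (flatten_slice (rank k) m lo cs f) =
      mval x (set_nth 0 m (rank k) 0) * uval (x k) (lo, cs) + lval x f.
  rewrite /uval /=; elim: cs lo => [|e cs IH] lo /=.
    by rewrite !mulr0 add0r.
  set r := flatten_slice _ _ _ _ _.
  have -> : lval x (if e == 0 then r else (set_nth 0 m (rank k) lo, e) :: r)
      = e%:~R * mval x (set_nth 0 m (rank k) lo) + lval x r.
    by case: eqP => [->|_]; rewrite ?mul0r ?add0r // /lval big_cons.
  rewrite {}/r IH mval_set addrA expfzDr // expr1z; congr (_ + _).
  by rewrite !mulrDr !mulrA; congr (_ + _); rewrite [RHS]mulrC mulrA.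
elim: g => [|t g IH]; first by rewrite /lval /sval !big_nil.
by rewrite /= flatE IH /sval big_cons -surjective_pairing.
Qed.

End SliceValues.

(** * Mutation of Laurent polynomials *)

Definition times_1p (cs : seq int) : seq int := madd cs (0 :: cs).

(** Synthetic division by 1 + y, lowest coefficient first; q is the previous
    coefficient of the quotient, and it must end at 0 for the division to be
    exact. *)
Fixpoint over_1p (q : int) (cs : seq int) : option (seq int) :=
  if cs is e :: cs' then
    omap (cons (e - q)) (over_1p (e - q) cs')
  else if q == 0 then Some [::] else None.

Fixpoint slices_over_1p (g : sliced) : option sliced :=
  if g is (m, (lo, cs)) :: g' then
    if over_1p 0 cs is Some r then
      omap (cons (m, (lo, r))) (slices_over_1p g')
    else None
  else Some [::].

Fixpoint strip_1p (n : nat) (g : sliced) : sliced :=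
  if n is n'.+1 then
    if slices_over_1p g is Some r then strip_1p n' r else g
  else g.

(** For an entry B of the exchange matrix, the power of x_k that is left when the
    factor of a mutation is written with 1 + x_k ([var_mutate]). *)
Definition positive_part (z : int) : nat := if z is Posz n then n else 0.

(** Here and below, col is column k of the exchange matrix. *)
Definition mutate_mono (k : nat) (col m : mono) : mono :=
  set_nth 0 m k (dot [seq Posz (positive_part e) | e <- col] m - m`_k).

(** y^shift (1 + y)^n q(1/y); inverting the variable reverses the coefficients. *)
Definition mutate_univariate (shift : int) (n : nat) (q : univariate)
  : univariate :=
  (shift - (q.1 + (size q.2).-1%:Z), iter n times_1p (rev q.2)).

(** The minimum of s and 0; if s is positive, the surplus powers of 1 + x_k are
    split off again by [strip_1p]. *)
Definition lower_bound (s : seq int) : int :=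
  foldr (fun z l => if z <= l then z else l) 0 s.

(** Excluding k keeps divisibility by 1 + x_k visible: modulo the Casimir
    monomial, the Laurent polynomials are then those in the remaining variables,
    x_k among them. *)
Definition unit_pivot (k : nat) (kap : mono) : nat :=
  find (fun i => (absz kap`_i == 1%N) && (i != k)) (iota 0 15).

(** The result f' of carrying f back through the mutation at k.  A slice with
    exponent vector m acquires the factor (1 + x_k)^(- dot col m); these powers
    are made nonnegative by the common factor (1 + x_k)^low.  The number of
    coefficients of a nonzero slice bounds how often 1 + x_k can be split off. *)
Definition mutate_laurent (k : nat) (col kap : mono) (f : laurent) : laurent :=
  let g := slice k (reduce kap (unit_pivot k kap) f) in
  let pos := [seq Posz (positive_part e) | e <- col] in
  let low := lower_bound [seq - dot col t.1 | t <- g] in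
  let h := [seq (t.1, mutate_univariate (dot pos t.1)
                        (positive_part (- dot col t.1 - low)) t.2) | t <- g] in
  unslice k (strip_1p (size (head ([::], (0, [::])) h).2.2) h).

Section OnePlus.

Variables (F : fieldType) (x : vertex -> F).

Lemma horner_times_1p y cs :
  horner_seq y (times_1p cs) = (1 + y) * horner_seq y cs :> F.
Proof. by rewrite horner_madd /= add0r mulrDl mul1r. Qed.

Lemma horner_rcons y cs e :
  horner_seq y (rcons cs e) = horner_seq y cs + y ^+ size cs * e%:~R :> F.
Proof.
elim: cs => [|d cs IH] /=; first by rewrite mulr0 addr0 add0r mul1r.
by rewrite IH mulrDr addrA exprS mulrA.
Qed.

Lemma horner_rev y cs : y != 0 ->
  horner_seq y (rev cs) = y ^+ (size cs).-1 * horner_seq y^-1 cs :> F.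
Proof.
move=> y0; elim: cs => [|e [|d cs] IH]; first by rewrite /= mulr0.
  by rewrite /= !mulr0 mul1r.
rewrite rev_cons horner_rcons IH size_rev.
set r := d :: cs; rewrite [RHS]mulrDr [RHS]addrC; congr (_ + _).
rewrite -[_.-1]/(size cs) -[(size (e :: r)).-1]/(size cs).+1.
by rewrite exprSr -mulrA mulVKf.
Qed.

(** The tail of cs after e satisfies the statement with e - q for q, and
    e + (e - q) y + (1 + y) y r = q + (1 + y) (e - q + y r). *)
Lemma horner_over_1p y q cs r : over_1p q cs = Some r ->
  horner_seq y cs = q%:~R + (1 + y) * horner_seq y r :> F.
Proof.
elim: cs q r => [|e cs IH] q r /=.
  by case: eqP => // -> [<-]; rewrite mulr0 addr0.
case E: (over_1p _ _) => [r'|] //= [<-] /=; rewrite (IH _ _ E).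
by rewrite intrB; ring.
Qed.

Lemma uval_mutate y shift n q : y != 0 ->
  uval y (mutate_univariate shift n q) =
    y ^ shift * (1 + y) ^+ n * uval y^-1 q :> F.
Proof.
move=> y0; rewrite /uval /mutate_univariate /=.
have -> : horner_seq y (iter n times_1p (rev q.2)) =
          (1 + y) ^+ n * horner_seq y (rev q.2).
  elim: n => [|n IH]; first by rewrite mul1r.
  by rewrite iterS horner_times_1p IH mulrA exprS.
rewrite horner_rev // opprD addrA !expfzDr // exprz_inv -exprnN.
set h := horner_seq _ _; have : y ^+ (size q.2).-1 != 0 by rewrite expf_neq0.
by move: (y ^+ _) => z z0; field.
Qed.

Lemma sval_over_1p k g r : slices_over_1p g = Some r ->
  sval x k g = (1 + x k) * sval x k r.
Proof.
elim: g r => [|[m [lo cs]] g IH] r /=.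
  by case=> <-; rewrite /sval !big_nil mulr0.
case Ecs: (over_1p 0 cs) => [ds|] //; case Eg: (slices_over_1p g) => [g'|] //=.
case=> <-; rewrite /sval !big_cons -!/(sval x k _) (IH _ Eg) /uval /=.
by rewrite (horner_over_1p _ Ecs) add0r; ring.
Qed.

End OnePlus.

Lemma sval_strip_1p (F : fieldType) k n g :
  exists i : nat, forall x : vertex -> F,
    sval x k g = (1 + x k) ^+ i * sval x k (strip_1p n g).
Proof.
elim: n g => [|n IH] g /=; first by exists 0 => x; rewrite mul1r.
case E: (slices_over_1p g) => [r|]; last by exists 0 => x; rewrite mul1r.
have [i ri] := IH r; exists i.+1 => x.
by rewrite (sval_over_1p x k E) ri mulrA exprS.
Qed.

Lemma lower_boundP s z : z \in s -> lower_bound s <= z.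
Proof.
elim: s => //= y s IH; rewrite inE => /orP[/eqP ->|/IH le_z].
  by case: ifP => // /negbT; rewrite -ltNge => /ltW.
by case: ifP => // le_y; exact: le_trans le_y le_z.
Qed.

Section MutationValues.

Variables (F : fieldType) (s : seed F) (k : vertex).
Let x := var s.
Let y := var (mutate k s).
Let B v := exchange (quiv s) v k.
Let col := [seq B v | v <- vertices].

Hypothesis x_neq0 : forall v, x v != 0.
Hypothesis xk_neqN1 : 1 + x k != 0.

(** The two signs of B give one formula because
    (1 + x_k^-1)^(-B) = x_k^B (1 + x_k)^(-B). *)
Lemma var_mutate v :
  y v = if v == k then (x k)^-1
        else x v * x k ^ (positive_part (B v))%:Z * (1 + x k) ^ (- B v).
Proof.
rewrite /y /= -/x -/(B v); case: eqP => // _.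
case: (B v) => [[|n]|n] /=.
- by rewrite oppr0 !expr0z !mulr1.
- rewrite gtr0_sg // -[in RHS]mulrA; congr (_ * _).
  rewrite exprN1 -!exprnN; have -> : 1 + (x k)^-1 = (1 + x k) / x k.
    by rewrite mulrDl mulfV // addrC mul1r.
  by rewrite expr_div_n invf_div.
- by rewrite ltr0_sg // opprK expr0z mulr1 expr1z.
Qed.

Lemma var_mutate_neq0 v : y v != 0.
Proof.
rewrite var_mutate; case: ifP => _; first by rewrite invr_eq0.
by rewrite !mulf_neq0 ?expfz_neq0.
Qed.

Lemma exchange_diag : B k = 0. Proof. exact: subrr. Qed.

Lemma dot_pos m :
  dot [seq (positive_part e)%:Z | e <- col] m =
    \sum_v (positive_part (B v))%:Z * m`_(rank v).
Proof. by rewrite -map_comp dot_vertices. Qed.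

(** Each neighbour v of k contributes x_k^(max(B_vk,0) m_v) (1 + x_k)^(-B_vk m_v),
    and k itself contributes x_k^(- m_k). *)
Lemma mval_mutate m :
  mval y m =
    mval x (mutate_mono (rank k) col m) * (1 + x k) ^ (- dot col m).
Proof.
have factor v : y v ^ m`_(rank v) =
    x v ^ (set_nth 0 m (rank k) 0)`_(rank v)
    * x k ^ ((positive_part (B v))%:Z * m`_(rank v))
    * (1 + x k) ^ (- (B v * m`_(rank v)))
    * (if v == k then x k ^ (- m`_(rank k)) else 1).
  rewrite var_mutate nth_set_nth /= (inj_eq rank_inj).
  case: eqP => [->|_].
    by rewrite exchange_diag !mul0r oppr0 !expr0z !mul1r exprz_inv.
  by rewrite !expfzMl !exprz_exp mulNr mulr1.
have big_expz (z : F) (G : vertex -> int) : z != 0 ->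
    \prod_v z ^ G v = z ^ (\sum_v G v).
  move=> z0.
  by rewrite (big_morph (exprz z) (fun m1 m2 => expfzDr m1 m2 z0) (expr0z z)).
rewrite [LHS](eq_bigr _ (fun v _ => factor v)) !big_split [LHS]/= !big_expz //.
rewrite -big_mkcond big_pred1_eq dot_vertices -sumrN /mutate_mono mval_set //.
by rewrite dot_pos expfzDr // [LHS]mulrAC !mulrA.
Qed.

End MutationValues.

(** The exponent e depends on f and on the quiver only, so the factor is one
    rational function on a whole family of seeds with the same quiver. *)
Lemma lval_mutate (F : fieldType) (k : vertex) (B : vertex -> int) kap f :
  let col := [seq B v | v <- vertices] in
  exists e : int, forall s : seed F,
    (forall v, var s v != 0) -> 1 + var s k != 0 ->
    (forall v, exchange (quiv s) v k = B v) ->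
    mval (var (mutate k s)) kap = 1 ->
    lval (var (mutate k s)) f =
      (1 + var s k) ^ e * lval (var s) (mutate_laurent (rank k) col kap f).
Proof.
move=> col; rewrite /mutate_laurent.
set p := unit_pivot _ _; set g := slice _ _.
set pos := [seq _ | e <- col]; set low := lower_bound _.
set h := [seq _ | t <- g]; set n := size _.
have [i stripE] := sval_strip_1p F k n h; exists (low + i%:Z) => s.
set x := var s; set y := var (mutate k s) => x_neq0 xk_neqN1 BE kap1.
have y_neq0 := var_mutate_neq0 x_neq0 xk_neqN1.
have colE : [seq exchange (quiv s) v k | v <- vertices] = col by exact: eq_map.
have Bk : B k = 0 by rewrite -BE exchange_diag.
rewrite lval_unslice // expfzDr // -mulrA -exprnP -stripE.
rewrite -(lval_reduce p f y_neq0 kap1) -(sval_slice y_neq0 k) -/g.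
rewrite /sval big_map mulr_sumr; apply: eq_big_seq => t gt /=.
rewrite mval_mutate // colE uval_mutate // /mutate_mono mval_set //.
set m0 := set_nth 0 t.1 _ _.
have dot_m0 (G : vertex -> int) : G k = 0 ->
    dot [seq G v | v <- vertices] m0 = dot [seq G v | v <- vertices] t.1.
  move=> Gk; rewrite !dot_vertices; apply: eq_bigr => v _.
  rewrite nth_set_nth /= (inj_eq rank_inj).
  by case: eqP => // ->; rewrite Gk !mul0r.
have -> : dot pos m0 = dot pos t.1.
  by rewrite /pos -map_comp dot_m0 //= Bk.
rewrite (dot_m0 B Bk) nth_set_nth /= eqxx subr0.
rewrite set_set_nth eqxx -/m0.
have low_le : 0 <= - dot col t.1 - low.
  by rewrite subr_ge0 lower_boundP // (map_f (fun t => - dot col t.1)).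
have -> : (1 + x k) ^ (- dot col t.1) =
    (1 + x k) ^ low * (1 + x k) ^+ positive_part (- dot col t.1 - low).
  rewrite exprnP -expfzDr //; congr (_ ^ _).
  case: (_ - low) low_le (subrK low (- dot col t.1)) => // z _ <-.
  by rewrite addrC.
rewrite ?[y k]var_mutate ?eqxx // -/x.
move: (mval x m0) (x k ^ _) ((1 + x k) ^ low) ((1 + x k) ^+ _) (uval _ _).
by move=> *; ring.
Qed.

(** * Quivers *)

(** Quivers are functions, and an arrow count after n mutations unfolds to
    exponentially many earlier ones; tables keep the values after each move. *)
Definition table := seq (seq nat).

Definition tabulate (Q : quiver) : table :=
  [seq [seq Q i j | j <- vertices] | i <- vertices].

Definition lookup (T : table) : quiver :=
  fun i j => nth 0%N (nth [::] T (rank i)) (rank j).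

Lemma lookup_tabulate Q : lookup (tabulate Q) =2 Q.
Proof.
move=> i j; rewrite /lookup (nth_map (a 0)) ?nth_vertices ?rank_lt //.
by rewrite (nth_map (a 0)) ?nth_vertices ?rank_lt.
Qed.

Definition swap (u v i : vertex) : vertex :=
  if i == u then v else if i == v then u else i.

Lemma tperm_swap u v : tperm u v =1 swap u v.
Proof. by move=> i; rewrite permE. Qed.

Definition move_table (m : move) (T : table) : table :=
  tabulate match m with
           | Mut k => mutate_quiver k (lookup T)
           | Relabel u v => fun i j => lookup T (swap u v i) (swap u v j)
           end.

Definition moves_table (ms : seq move) (T : table) : table :=
  foldl (fun T m => move_table m T) T ms.

Lemma quiv_move (F : fieldType) (m : move) (s : seed F) T :
  quiv s =2 lookup T -> quiv (apply_move m s) =2 lookup (move_table m T).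
Proof.
move=> sT i j; rewrite lookup_tabulate; case: m => [k|u v] /=.
  rewrite /mutate_quiver /cancel_2cycles /reverse_at /add_paths !sT.
  by case: ifP.
by rewrite sT !tperm_swap.
Qed.

Lemma quiv_moves (F : fieldType) (ms : seq move) (s : seed F) T :
  quiv s =2 lookup T -> quiv (apply_moves ms s) =2 lookup (moves_table ms T).
Proof. by elim: ms s T => //= m ms IH s T /(quiv_move m) /IH. Qed.

(** * Transporting Laurent polynomials along moves *)

(** The exponents of a Casimir monomial and a Laurent polynomial, the latter
    considered on the hypersurface where the former has value 1. *)
Definition state := (mono * laurent)%type.

Definition swap_mono (u v : vertex) (m : mono) : mono :=
  [seq m`_(rank (swap u v i)) | i <- vertices].

(** Rewrites a state of the seed after the move in the variables of the seed
    before it, dropping powers of 1 + x_k from the Laurent polynomial.  The test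
    on dot says that the monomial acquires no such power. *)
Definition pull_move (m : move) (T : table) (q : state) : option state :=
  match m with
  | Mut k =>
      let col := [seq exchange (lookup T) v k | v <- vertices] in
      if dot col q.1 == 0 then
        Some (mutate_mono (rank k) col q.1,
              mutate_laurent (rank k) col q.1 q.2)
      else None
  | Relabel u v =>
      Some (swap_mono u v q.1, [seq (swap_mono u v t.1, t.2) | t <- q.2])
  end.

Fixpoint pull (ms : seq move) (T : table) (q : state) : option state :=
  if ms is m :: ms' then
    obind (pull_move m T) (pull ms' (move_table m T) q)
  else Some q.

Definition collect (f : laurent) : laurent := unslice 0 (slice 0 f).

Definition lmul_term (m : mono) (e : int) (f : laurent) : laurent :=
  [seq (madd m t.1, e * t.2) | t <- f].

(** Equality up to sign and a monomial, modulo the monomial of kap.  The sorted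
    order is invariant under translation of the exponents, so the leading terms
    tell which monomial is needed.  No variable has rank 15, so every pivot is
    allowed. *)
Definition associated (kap : mono) (f g : laurent) : bool :=
  let p := unit_pivot 15 kap in
  let f' := collect (reduce kap p f) in
  let g' := collect (reduce kap p g) in
  let m := madd (head ([::], 0) g').1 (mscale (-1) (head ([::], 0) f').1) in
  (lmul_term m 1 f' == g') || (lmul_term m (-1) f' == g').

Definition transports (ms : seq move) (T : table) (q q' : state) : bool :=
  if pull ms T q' is Some r then (r.1 == q.1) && associated q.1 r.2 q.2
  else false.

Section Transport.

Variable F : fieldType.

Lemma lval_collect (x : vertex -> F) f :
  (forall v, x v != 0) -> lval x (collect f) = lval x f.
Proof.
by move=> x_neq0; rewrite (lval_unslice x_neq0 (a 0)) (sval_slice x_neq0 (a 0)).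
Qed.

Lemma lval_mul_term (x : vertex -> F) m e f : (forall v, x v != 0) ->
  lval x (lmul_term m e f) = e%:~R * mval x m * lval x f.
Proof.
move=> x_neq0; rewrite /lval big_map mulr_sumr; apply: eq_bigr => t _ /=.
by rewrite mval_add // intrM mulrACA.
Qed.

Lemma associatedP kap f g : associated kap f g ->
  exists e m, e%:~R != 0 :> F /\ forall x : vertex -> F,
    (forall v, x v != 0) -> mval x kap = 1 ->
    lval x g = e%:~R * mval x m * lval x f.
Proof.
rewrite /associated; set p := unit_pivot _ _; set m := madd _ _.
move=> assoc.
have [e e_neq0 /eqP assoc_e] : exists2 e : int, e%:~R != 0 :> F &
    lmul_term m e (collect (reduce kap p f)) == collect (reduce kap p g).
  by case/orP: assoc => ?; [exists 1|exists (-1)] => //;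
    rewrite ?mulrNz ?oppr_eq0 oner_neq0.
exists e, m; split=> // x x_neq0 kap1.
rewrite -(lval_reduce p g x_neq0 kap1) -lval_collect // -assoc_e.
by rewrite lval_mul_term // lval_collect // lval_reduce.
Qed.

Variable D : (vertex -> F) -> Prop.

(** Functions that on D are a quotient of polynomials without zeros on D.  They
    contain the variables of all seeds met on the way, and these factors are what
    separates the minors of two Cases. *)
Definition rational_unit (g : (vertex -> F) -> F) : Prop :=
  exists N E : {mpoly F[#|vertex|]}, forall x, D x ->
    [/\ eval_at x N != 0, eval_at x E != 0 & g x = eval_at x N / eval_at x E].

Lemma rational_unit_neq0 g x : rational_unit g -> D x -> g x != 0.
Proof.
case=> N [E NE] /NE[N0 E0 ->]; by rewrite mulf_neq0 ?invr_eq0.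
Qed.

Lemma rational_unit_ext g h :
  (forall x, D x -> g x = h x) -> rational_unit g -> rational_unit h.
Proof.
by move=> gh [N [E NE]]; exists N, E => x Dx; rewrite -gh //; exact: NE.
Qed.

Lemma rational_unit_const e : e != 0 -> rational_unit (fun=> e).
Proof.
move=> e0; exists e%:MP, 1%:MP => x _; rewrite /eval_at !mevalC.
by rewrite e0 oner_neq0 divr1.
Qed.

Lemma rational_unit_coord v :
  (forall x, D x -> x v != 0) -> rational_unit (fun x => x v).
Proof.
move=> v0; exists 'X_(enum_rank v), 1%:MP => x Dx; rewrite /eval_at.
by rewrite mevalXU mevalC enum_rankK v0 ?oner_neq0 ?divr1.
Qed.

Lemma rational_unitM g h :
  rational_unit g -> rational_unit h -> rational_unit (fun x => g x * h x).
Proof.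
move=> [N [E NE]] [N' [E' NE']]; exists (N * N'), (E * E') => x Dx.
have [N0 E0 ->] := NE x Dx; have [N0' E0' ->] := NE' x Dx.
by rewrite /eval_at !mevalM !mulf_neq0 // invfM mulrACA.
Qed.

Lemma rational_unitV g : rational_unit g -> rational_unit (fun x => (g x)^-1).
Proof.
move=> [N [E NE]]; exists E, N => x Dx.
by have [N0 E0 ->] := NE x Dx; rewrite invf_div.
Qed.

Lemma rational_unitX g (e : int) :
  rational_unit g -> rational_unit (fun x => g x ^ e).
Proof.
move=> gu; have expn n : rational_unit (fun x => g x ^+ n).
  elim: n => [|n IH]; first exact: rational_unit_const (oner_neq0 F).
  apply: rational_unit_ext (rational_unitM gu IH) => x _.
  by rewrite exprS.
case: e => n; first exact: expn.
exact: rational_unitV (expn n.+1).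
Qed.

Lemma rational_unit_1p g : rational_unit g ->
  (forall x, D x -> 1 + g x != 0) -> rational_unit (fun x => 1 + g x).
Proof.
move=> [N [E NE]] g1; exists (E + N), E => x Dx.
have [N0 E0 gE] := NE x Dx; have := g1 x Dx; rewrite gE.
have -> : 1 + eval_at x N / eval_at x E = eval_at x (E + N) / eval_at x E.
  by rewrite /eval_at mevalD mulrDl mulfV.
by rewrite mulf_eq0 negb_or => /andP[].
Qed.

(** A seed depending rationally on the initial variables, with a fixed quiver. *)
Definition tracked (s : (vertex -> F) -> seed F) (T : table) : Prop :=
  (forall x, D x -> quiv (s x) =2 lookup T) /\
  (forall v, rational_unit (fun x => var (s x) v)).

Lemma tracked_move s T m : tracked s T ->
  (forall x, D x -> mutable_along [:: m] (s x)) ->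
  tracked (fun x => apply_move m (s x)) (move_table m T).
Proof.
move=> [sT su] mut; split=> [x Dx|v]; first by apply: quiv_move; exact: sT.
case: m mut => [k|u w] mut; last exact: su.
have xk_neqN1 x : D x -> 1 + var (s x) k != 0.
  by move=> /mut /=; rewrite andbT.
have BE x v' : D x -> exchange (quiv (s x)) v' k = exchange (lookup T) v' k.
  by move=> Dx; rewrite /exchange !sT.
apply: (@rational_unit_ext (fun x => if v == k then (var (s x) k)^-1 else
    var (s x) v * var (s x) k ^ (positive_part (exchange (lookup T) v k))%:Z
    * (1 + var (s x) k) ^ (- exchange (lookup T) v k))).
  move=> x Dx; rewrite var_mutate ?BE ?xk_neqN1 // => w.
  exact: rational_unit_neq0 (su w) Dx.
case: (v == k); first exact: rational_unitV.
apply: rational_unitM; last by apply/rational_unitX/rational_unit_1p.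
by apply: rational_unitM => //; exact: rational_unitX.
Qed.

Lemma mutable_along_cat ms1 ms2 (s : seed F) :
  mutable_along (ms1 ++ ms2) s =
    mutable_along ms1 s && mutable_along ms2 (apply_moves ms1 s).
Proof. by elim: ms1 s => //= m ms1 IH s; rewrite IH andbA. Qed.

Lemma tracked_moves s T ms : tracked s T ->
  (forall x, D x -> mutable_along ms (s x)) ->
  tracked (fun x => apply_moves ms (s x)) (moves_table ms T).
Proof.
elim: ms s T => [|m ms IH] s T //= sT mut; apply: (IH (fun x => _)).
  by apply: tracked_move => // x /mut /=; rewrite andbT => /andP[].
by move=> x /mut /andP[].
Qed.

(** On the domain D, the state q of s and the state q' of s' have the same
    Casimir value and, where it is 1, Laurent polynomials that agree up to a
    rational unit. *)
Definition transported (s s' : (vertex -> F) -> seed F) (q q' : state) : Prop :=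
  exists2 g, rational_unit g & forall x, D x ->
    mval (var (s x)) q.1 = mval (var (s' x)) q'.1 /\
    (mval (var (s x)) q.1 = 1 ->
       lval (var (s x)) q.2 = g x * lval (var (s' x)) q'.2).

Lemma transported_trans s1 s2 s3 q1 q2 q3 :
  transported s1 s2 q1 q2 -> transported s2 s3 q2 q3 ->
  transported s1 s3 q1 q3.
Proof.
move=> [g gu gE] [h hu hE]; exists (fun x => g x * h x).
  exact: rational_unitM.
move=> x Dx; have [k12 l12] := gE x Dx; have [k23 l23] := hE x Dx.
split=> [|k1]; first by rewrite k12.
by rewrite l12 // l23 ?mulrA // -k12.
Qed.

Lemma mval_relabel u v (s : seed F) m :
  mval (var (relabel u v s)) m = mval (var s) (swap_mono u v m).
Proof.
rewrite /mval (reindex_inj (@perm_inj _ (tperm u v))) /=.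
apply: eq_bigr => i _; rewrite tpermK (nth_map (a 0)) ?rank_lt //.
by rewrite nth_vertices tperm_swap.
Qed.

Lemma pull_move_transported m s T q q' : tracked s T ->
  (forall x, D x -> mutable_along [:: m] (s x)) ->
  pull_move m T q' = Some q ->
  transported s (fun x => apply_move m (s x)) q q'.
Proof.
move=> [sT su] mut; case: m mut => [k|u v] mut; rewrite /pull_move; last first.
  case=> <-; exists (fun=> 1); first exact: rational_unit_const (oner_neq0 F).
  move=> x Dx /=; rewrite mval_relabel; split=> // _.
  rewrite mul1r /lval big_map; apply: eq_bigr => t _.
  by rewrite mval_relabel.
set col := map _ _; case: eqP => // dot0 [<-].
have [e lvalE] :=
  lval_mutate F k (fun v => exchange (lookup T) v k) q'.1 q'.2.
have xk_neqN1 x : D x -> 1 + var (s x) k != 0.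
  by move=> /mut /=; rewrite andbT.
exists (fun x => (1 + var (s x) k) ^ (- e)).
  by apply/rational_unitX/rational_unit_1p.
move=> x Dx; have x_neq0 v : var (s x) v != 0.
  exact: rational_unit_neq0 (su v) Dx.
have BE v : exchange (quiv (s x)) v k = exchange (lookup T) v k.
  by rewrite /exchange !sT.
have colE : [seq exchange (quiv (s x)) v k | v <- vertices] = col.
  exact: eq_map.
have kE : mval (var (s x)) (mutate_mono (rank k) col q'.1) =
          mval (var (mutate k (s x))) q'.1.
  by rewrite mval_mutate ?xk_neqN1 // colE dot0 oppr0 expr0z mulr1.
split=> //= k1; rewrite lvalE ?xk_neqN1 -?kE // mulrA -expfzDr ?xk_neqN1 //.
by rewrite addNr expr0z mul1r.
Qed.

Lemma pull_transported ms s T q q' : tracked s T ->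
  (forall x, D x -> mutable_along ms (s x)) -> pull ms T q' = Some q ->
  transported s (fun x => apply_moves ms (s x)) q q'.
Proof.
elim: ms s T q => [|m ms IH] s T q sT mut /=.
  case=> <-; exists (fun=> 1); first exact: rational_unit_const (oner_neq0 F).
  by move=> x _; split=> // _; rewrite mul1r.
case E: (pull ms _ q') => [q1|] //= pm.
have mutm x : D x -> mutable_along [:: m] (s x).
  by move=> /mut /=; rewrite andbT => /andP[].
apply: transported_trans (pull_move_transported sT mutm pm) _.
apply: IH E; first exact: tracked_move.
by move=> x /mut /= /andP[].
Qed.

Lemma transports_transported ms s T q q' : tracked s T ->
  (forall x, D x -> mutable_along ms (s x)) -> transports ms T q q' ->
  transported s (fun x => apply_moves ms (s x)) q q'.
Proof.
move=> sT mut; rewrite /transports; case E: (pull ms T q') => [r|] //.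
case/andP=> /eqP rq /associatedP[e [m [e0 assoc]]].
apply: transported_trans (pull_transported sT mut E).
exists (fun x => e%:~R * mval (var (s x)) m).
  apply: rational_unitM; first exact: rational_unit_const.
  rewrite /mval; elim: (index_enum _) => [|v vs IH].
    apply: rational_unit_ext (rational_unit_const (oner_neq0 F)) => x _.
    by rewrite big_nil.
  have xu := rational_unitX m`_(rank v) (sT.2 v).
  by apply: rational_unit_ext (rational_unitM xu IH) => x _; rewrite big_cons.
move=> x Dx; rewrite rq; split=> // k1; apply: assoc k1 => v.
exact: rational_unit_neq0 (sT.2 v) Dx.
Qed.

End Transport.

(** * Casimir functions and minors *)

(** The exponent vector of the product of the variables in vs. *)
Definition content (vs : seq vertex) : mono :=
  [seq (count_mem v vs)%:Z | v <- vertices].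

Definition p_laurent (i k : nat) : laurent :=
  if (i + k < 7)%N then [::] else
  let ls := iota (7 - k) (i + k - 7) in
  [seq (content (flatten [seq T l | l <- index_iota 1 (7 - k)] ++
                 flatten [seq take q.2.-1 (u q.1) | q <- zip ls s]), 1)
     | s <- boxed ls & sorted geq s].

Definition psi_laurent (i k : nat) : laurent :=
  lmul_term [::] ((-1) ^+ k) (p_laurent i k) ++
  lmul_term [::] ((-1) ^+ i) (p_laurent k i).

Definition lmul (f g : laurent) : laurent :=
  flatten [seq lmul_term t.1 t.2 g | t <- f].

(** Laplace expansion along the first row. *)
Fixpoint ldet (n : nat) (M : nat -> nat -> laurent) : laurent :=
  if n is n'.+1 then
    collect (flatten
      [seq lmul_term [::] ((-1) ^+ k)
             (lmul (M 0 k) (ldet n' (fun i j => M i.+1 (bump k j))))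
         | k <- iota 0 n])
  else [:: ([::], 1)].

Definition block_laurent (lo hi : nat) : laurent :=
  let n := (hi.+1 - lo)%N in
  let rows := [seq [seq collect (psi_laurent (lo + i) (lo + k)) | k <- iota 0 n]
                 | i <- iota 0 n] in
  ldet n (fun i k => nth [::] (nth [::] rows i) k).

Definition casimir_mono (j : 'Z_3) : mono :=
  match val j with
  | 1%N => nseq 6 0 ++ nseq 6 0 ++ nseq 3 1
  | 2%N => nseq 6 0 ++ nseq 6 1 ++ nseq 3 1
  | _ => nseq 6 1 ++ nseq 6 1 ++ nseq 3 1
  end.

Definition minor_laurent (j : 'Z_3) : laurent :=
  match val j with
  | 1%N => psi_laurent 4 4
  | 2%N => block_laurent 3 5
  | _ => block_laurent 2 6
  end.

Definition case_state (j : 'Z_3) : state := (casimir_mono j, minor_laurent j).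

Section CaseValues.

Variables (F : fieldType) (x : vertex -> F).
Hypothesis x_neq0 : forall v, x v != 0.

Lemma mval_nil : mval x [::] = 1.
Proof. by rewrite /mval big1 // => v _; rewrite nth_nil. Qed.

Lemma mval_content vs : mval x (content vs) = mon x vs.
Proof.
have contentE v vs' : (content vs')`_(rank v) = (count_mem v vs')%:Z.
  by rewrite (nth_map (a 0)) ?rank_lt // nth_vertices.
rewrite /mon; elim: vs => [|w vs IH].
  by rewrite big_nil /mval big1 // => v _; rewrite contentE.
rewrite big_cons -IH /mval [in LHS](bigD1 w) // [in RHS](bigD1 w) //= mulrA.
congr (_ * _); first by rewrite !contentE /= eqxx -exprS.
by apply: eq_bigr => v vw; rewrite !contentE /= eq_sym (negPf vw).
Qed.

Lemma lval_cat f g : lval x (f ++ g) = lval x f + lval x g.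
Proof. exact: big_cat. Qed.

Lemma lval_p i k : lval x (p_laurent i k) = p x i k.
Proof.
rewrite /p_laurent /p; case: ifP => _; first exact: big_nil.
rewrite /lval big_map big_filter mulr_sumr; apply: eq_bigr => s _ /=.
by rewrite mul1r mval_content /mon big_cat !big_flatten !big_map.
Qed.

Lemma lval_psi i k : lval x (psi_laurent i k) = psi x i k.
Proof.
rewrite lval_cat !lval_mul_term // !lval_p mval_nil !mulr1.
by rewrite !rmorphXn /= !rmorphN1.
Qed.

Lemma lval_mul f g : lval x (lmul f g) = lval x f * lval x g.
Proof.
rewrite /lval big_flatten big_map mulr_suml; apply: eq_bigr => t _.
exact: lval_mul_term.
Qed.

Lemma lval_det n M :
  lval x (ldet n M) = \det (\matrix_(i < n, k < n) lval x (M i k)).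
Proof.
elim: n M => [|n IH] M.
  by rewrite det_mx00 /lval big_seq1 mval_nil mulr1.
rewrite (expand_det_row _ ord0) /ldet -/ldet lval_collect //.
rewrite /lval big_flatten big_map -/(index_iota 0 n.+1) big_mkord.
apply: eq_bigr => k _; apply: etrans (lval_mul_term _ _ _ x_neq0) _.
rewrite mval_nil mulr1 lval_mul IH mxE mulrCA rmorphXn rmorphN1.
congr (_ * (_ * _)).
by congr (\det _); apply/matrixP => i j; rewrite !mxE.
Qed.

Lemma lval_block lo hi :
  lval x (block_laurent lo hi) = \det (Psi_block x lo hi).
Proof.
rewrite lval_det; congr (\det _); apply/matrixP => i k; rewrite !mxE.
rewrite (nth_map 0%N) ?size_iota // (nth_map 0%N) ?size_iota //.
by rewrite !nth_iota // !add0n lval_collect // lval_psi.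
Qed.

Lemma casimirE j : casimir j x = mval x (casimir_mono j).
Proof.
have blocks e1 e2 e3 :
    mval x (nseq 6 e1 ++ nseq 6 e2 ++ nseq 3 e3) =
      \prod_i x (a i) ^ e1 * \prod_i x (b i) ^ e2 * \prod_i x (c i) ^ e3.
  rewrite /mval !big_sumType /=; congr (_ * _ * _);
    apply: eq_bigr => -[i lti] _; congr (_ ^ _); by do 6?[case: i lti => [|i] lti //].
have pow0 n (G : 'I_n -> F) : \prod_i G i ^ 0%:Z = 1.
  by rewrite big1 // => i _; rewrite expr0z.
rewrite /casimir /casimir_mono; case: (val j) => [|[|[|n]]];
  by rewrite blocks ?pow0 ?mul1r.
Qed.

Lemma case_minorE j : case_minor j x = lval x (minor_laurent j).
Proof.
rewrite /case_minor /minor_laurent.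
by case: (val j) => [|[|[|n]]]; rewrite ?lval_block ?lval_psi.
Qed.

End CaseValues.

(** For i + k = 7 each of p_ik and p_ki is a single monomial, and the second
    exceeds the first by the factor K_j. *)
Lemma first_conditionE (F : fieldType) (j : 'Z_3) (x : vertex -> F) :
  (forall v, x v != 0) -> (first_condition j x <-> casimir j x = 1).
Proof.
move=> x_neq0.
have conditionE (i k : nat) m : odd i = ~~ odd k ->
    p_laurent i k = [:: (m, 1)] ->
    p_laurent k i = [:: (madd m (casimir_mono j), 1)] ->
    (psi x i k = 0 /\ psi x k i = 0) <-> casimir j x = 1.
  move=> odd_ik pik pki.
  have pikE : p x i k = mval x m by rewrite -lval_p pik /lval big_seq1 mul1r.
  have pkiE : p x k i = mval x m * casimir j x.
    by rewrite -lval_p pki /lval big_seq1 mul1r mval_add // casimirE.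
  rewrite /psi pikE pkiE; have m0 := mval_neq0 x_neq0 m.
  have -> : (-1) ^+ i = - (-1) ^+ k :> F.
    rewrite -signr_odd -[in RHS]signr_odd odd_ik.
    by case: (odd k); rewrite ?opprK.
  split=> [[psi0 _]|->]; last by rewrite mulr1 mulNr subrr addNr.
  have : (-1) ^+ k * mval x m * (1 - casimir j x) = 0 by rewrite -psi0; ring.
  by move/eqP; rewrite !mulf_eq0 signr_eq0 (negPf m0) subr_eq0 => /eqP.
rewrite /first_condition.
by case: j => [[|[|[|j]]] ltj] in conditionE *; rewrite //=;
  apply: conditionE; vm_compute.
Qed.

(** * The two mutation sequences *)

Definition P_moves := muts P_vertices.
Definition Pinv_moves := muts (rev P_vertices).
Definition middle1 := muts [:: b 1; b 4] ++ [:: Relabel (b 1) (b 4)].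
Definition middle2 :=
  muts [:: b 1; b 4] ++ muts [:: b 1; b 4] ++ muts [:: b 3; b 5] ++
  [:: Relabel (b 1) (b 4); Relabel (b 3) (b 5)] ++ muts [:: b 1; b 4].

Definition A6_table : table := tabulate A6_quiver.
Definition P_table : table := moves_table P_moves A6_table.

(** 1 -> 3 -> 2 -> 1, with 3 = 0. *)
Definition cycle3 : {perm 'Z_3} := perm (@addIr 'Z_3 (-1)).

(** Each q_j, a state after post, is carried back to a state h_j before it, and
    pre relates q_j to h_j again; the middle parts permute the h_j. *)
Definition certificate (pre mid1 mid2 post : seq move) (T T' : table)
    (q0 q1 q2 : state) : bool :=
  match pull post T' q0, pull post T' q1, pull post T' q2 with
  | Some h0, Some h1, Some h2 =>
    [&& transports pre T q0 h0, transports pre T q1 h1, transports pre T q2 h2,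
        transports mid1 T' h1 h1, transports mid1 T' h2 h0,
        transports mid1 T' h0 h2, transports mid2 T' h1 h0,
        transports mid2 T' h2 h1 & transports mid2 T' h0 h2]
  | _, _, _ => false
  end.

Lemma Z3_cases (j : 'Z_3) : j = 0 \/ j = 1 \/ j = 2.
Proof.
by case: j => [[|[|[|j]]] ltj] //; [left|right; left|right; right];
  apply: val_inj.
Qed.

Lemma certificateP pre mid1 mid2 post T T' (q : 'Z_3 -> state) :
  certificate pre mid1 mid2 post T T' (q 0) (q 1) (q 2) ->
  exists h : 'Z_3 -> state, forall j,
    [/\ transports pre T (q j) (h j), pull post T' (q j) = Some (h j),
        transports mid1 T' (h j) (h (tperm 2 3 j)) &
        transports mid2 T' (h j) (h (cycle3 j))].
Proof.
rewrite /certificate; case E0: (pull post T' (q 0)) => [h0|] //.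
case E1: (pull post T' (q 1)) => [h1|] //.
case E2: (pull post T' (q 2)) => [h2|] //.
move=> /and5P[t0 t1 t2 m11 /and5P[m20 m02 n10 n21 n02]].
exists (fun j => match val j with 0%N => h0 | 1%N => h1 | _ => h2 end) => j.
have swap_cycle : [/\ tperm 2 3 0 = 2 :> 'Z_3, tperm 2 3 1 = 1 :> 'Z_3,
    tperm 2 3 2 = 0 :> 'Z_3 & [/\ cycle3 0 = 2, cycle3 1 = 0 & cycle3 2 = 1]].
  by split; [..|split]; rewrite permE; apply: val_inj.
have [[s0 s1 s2 [c0 c1 c2]] [->|[->|->]]] := (swap_cycle, Z3_cases j).
- by rewrite s0 c0; exact: And4 t0 E0 m02 n02.
- by rewrite s1 c1; exact: And4 t1 E1 m11 n10.
- by rewrite s2 c2; exact: And4 t2 E2 m20 n21.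
Qed.

Lemma middle1_table : moves_table middle1 P_table = P_table.
Proof. by vm_compute. Qed.

Lemma middle2_table : moves_table middle2 P_table = P_table.
Proof. by vm_compute. Qed.

Lemma P_inv_table : moves_table Pinv_moves P_table = A6_table.
Proof. by vm_compute. Qed.

Lemma certificate_holds :
  certificate P_moves middle1 middle2 Pinv_moves A6_table P_table
    (case_state 0) (case_state 1) (case_state 2).
Proof. vm_cast_no_check (erefl true). Qed.

(** Case j in the initial seed is compared with h in the seed after P, h with h'
    in the seed after the middle part, and h' with Case j' in the final seed. *)
Lemma sequence_transported (F : fieldType) middle (j j' : 'Z_3) h h' :
  moves_table middle P_table = P_table ->
  transports P_moves A6_table (case_state j) h ->
  transports middle P_table h h' ->
  pull Pinv_moves P_table (case_state j') = Some h' ->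
  let ms := P_moves ++ middle ++ Pinv_moves in
  exists2 g, rational_unit (@in_domain F ms) g & forall x, in_domain ms x ->
    [/\ forall v, new_vars ms x v != 0,
        casimir j x = casimir j' (new_vars ms x) &
        first_condition j x ->
          case_minor j x = g x * case_minor j' (new_vars ms x)].
Proof.
move=> mid_table P_h mid_h Pinv_h ms; set D := in_domain ms.
have s0 : tracked D (@A6_seed F) A6_table.
  split=> [x _ i k|v]; first by rewrite lookup_tabulate.
  by apply: rational_unit_coord => x [].
have mutP x : D x -> mutable_along P_moves (A6_seed x).
  by case=> _; rewrite mutable_along_cat => /andP[].
have s1 := tracked_moves s0 mutP; rewrite -/P_table in s1.
have mutM x : D x -> mutable_along middle (apply_moves P_moves (A6_seed x)).
  by case=> _; rewrite !mutable_along_cat => /and3P[].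
have s2 := tracked_moves s1 mutM; rewrite mid_table in s2.
have mutI x : D x -> mutable_along Pinv_moves
    (apply_moves middle (apply_moves P_moves (A6_seed x))).
  by case=> _; rewrite !mutable_along_cat => /and3P[].
have s3 := tracked_moves s2 mutI.
have [g gu gE] := transported_trans (transports_transported s0 mutP P_h)
  (transported_trans (transports_transported s1 mutM mid_h)
                     (pull_transported s2 mutI Pinv_h)).
exists g => // x Dx; have [kE lE] := gE x Dx.
have x_neq0 : forall v, x v != 0 by case: Dx.
have newE : new_vars ms x = var (apply_moves Pinv_moves
    (apply_moves middle (apply_moves P_moves (A6_seed x)))).
  by rewrite /new_vars /apply_moves !foldl_cat.
have z_neq0 v : new_vars ms x v != 0.
  by rewrite newE; exact: rational_unit_neq0 (s3.2 v) Dx.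
split=> //; first by rewrite !casimirE // newE.
move=> /(first_conditionE _ x_neq0); rewrite casimirE // => /lE.
by rewrite !case_minorE // newE.
Qed.

Lemma order_cycle3 : #[cycle3]%g = 3%N.
Proof.
apply: nt_prime_order => //.
  apply/permP => j; rewrite !expgS expg0 mulg1 !permM !permE /=.
  by case: j => [[|[|[|j]]] ltj] //; apply: val_inj.
by apply/eqP => /permP /(_ 0); rewrite !permE => /eqP.
Qed.

(** The middle part preserves the quiver reached by P, and P^-1 undoes P. *)
Lemma conjugated_middle_returns (F : fieldType) middle :
  moves_table middle P_table = P_table ->
  returns_quiver F (P_moves ++ middle ++ Pinv_moves).
Proof.
move=> mid_table x i k.
have Q0 : quiv (A6_seed x) =2 lookup A6_table.
  by move=> i' k'; rewrite lookup_tabulate.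
rewrite (quiv_moves _ Q0) /moves_table !foldl_cat -!/(moves_table _ _).
by rewrite -/P_table mid_table P_inv_table lookup_tabulate.
Qed.

(** A factor g without zeros carries the vanishing of one minor to the other, and
    the first conditions correspond because they say that the Casimir functions
    are 1. *)
Lemma permutes_of_minors (F : fieldType) ms (tau : {perm 'Z_3}) :
  (forall j, exists2 g, rational_unit (@in_domain F ms) g &
     forall x, in_domain ms x ->
       [/\ forall v, new_vars ms x v != 0,
           casimir j x = casimir (tau j) (new_vars ms x) &
           first_condition j x ->
             case_minor j x = g x * case_minor (tau j) (new_vars ms x)]) ->
  [/\ permutes_casimirs F ms tau, permutes_cases F ms tau &
      forall j, minor_becomes F ms j (tau j)].
Proof.
move=> transp; split=> [j x Dx|j x Dx|j].
- by have [g _ /(_ x Dx)[]] := transp j.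
- have [g gu /(_ x Dx)[z_neq0 kE lE]] := transp j.
  have firstE : first_condition j x <-> first_condition (tau j) (new_vars ms x).
    rewrite (first_conditionE _ z_neq0) -kE.
    exact: first_conditionE (proj1 Dx).
  split=> //; split=> [[] fx mx|[] fz mz].
    split; first exact/firstE.
    have /eqP := lE fx; rewrite mx eq_sym mulf_eq0.
    by rewrite (negPf (rational_unit_neq0 gu Dx)) => /eqP.
  by have fx := proj2 firstE fz; split; rewrite ?lE // mz mulr0.
have [g [N [E NE]] gE] := transp j; exists N, E => x Dx fx.
have [_ _ /(_ fx)] := gE x Dx; have [N0 E0 ->] := NE x Dx.
by split.
Qed.

Theorem mainTheorem4 (F : fieldType) (charF0 : [pchar F] =i pred0) :
  [/\ returns_quiver F first_sequence,
      permutes_casimirs F first_sequence (tperm 2 3),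
      minor_becomes F first_sequence 2 3,
      minor_becomes F first_sequence 3 2 &
      permutes_cases F first_sequence (tperm 2 3)] /\
  (returns_quiver F second_sequence /\
   exists tau : {perm 'Z_3},
     [/\ #[tau]%g = 3%N,
         permutes_casimirs F second_sequence tau &
         permutes_cases F second_sequence tau]).
Proof.
have [h hP] := certificateP certificate_holds.
have first_moves : first_sequence = P_moves ++ middle1 ++ Pinv_moves.
  by rewrite /first_sequence !catA.
have second_moves : second_sequence = P_moves ++ middle2 ++ Pinv_moves.
  by rewrite /second_sequence !catA.
have [casimirs1 cases1 minors1] :
  [/\ permutes_casimirs F first_sequence (tperm 2 3),
    permutes_cases F first_sequence (tperm 2 3) &
    forall j, minor_becomes F first_sequence j (tperm 2 3 j)].
  apply: permutes_of_minors => j; have [pre post mid1 _] := hP j.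
  have [_ post' _ _] := hP (tperm 2 3 j).
  rewrite first_moves.
  exact: sequence_transported middle1_table pre mid1 post'.
have [casimirs2 cases2 _] :
  [/\ permutes_casimirs F second_sequence cycle3,
    permutes_cases F second_sequence cycle3 &
    forall j, minor_becomes F second_sequence j (cycle3 j)].
  apply: permutes_of_minors => j; have [pre post _ mid2] := hP j.
  have [_ post' _ _] := hP (cycle3 j).
  rewrite second_moves.
  exact: sequence_transported middle2_table pre mid2 post'.
split; [split=> //|split].
- by rewrite first_moves; exact: conjugated_middle_returns middle1_table.
- by have := minors1 2; rewrite tpermL.
- by have := minors1 3; rewrite tpermR.
- by rewrite second_moves; exact: conjugated_middle_returns middle2_table.
by exists cycle3; rewrite order_cycle3.
Qed.
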